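(* For every graph $G$ and every positive integer $t$, $$\chi(G)=\chi^{\underline{t}}(G\boxtimes K_t).$$
   Context: Graphs are finite and simple. $\chi$ is the usual chromatic number. A colouring of a graph is $t$-clustered if every monochromatic component (connected component of the subgraph induced by a colour class) contains at most $t$ vertices; $\chi^{\underline{t}}$ denotes the least number of colours in a $t$-clustered colouring. The strong product $G\boxtimes H$ has vertex set $V(G)\times V(H)$, where $(u,u')$ and $(v,v')$ are adjacent if (i) $u=v$ and $u'\sim v'$ in $H$, or (ii) $u'=v'$ and $u\sim v$ in $G$, or (iii) $u\sim v$ in $G$ and $u'\sim v'$ in $H$. $K_t$ is the complete graph on $t$ vertices. *)

(* Defs.v *)
From mathcomp Require Import all_boot.

Set Implicit Arguments.
Unset Strict Implicit.
Unset Printing Implicit Defensive.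

Record sgraph := SGraph {
  vertex :> finType;
  adj : rel vertex;
  adj_sym : symmetric adj;
  adj_irrefl : irreflexive adj
}.

Definition complete_adj (t : nat) : rel 'I_t := [rel x y | x != y].

Lemma complete_adj_sym t : symmetric (@complete_adj t).
Proof. by move=> x y; apply: (congr1 negb); apply: eq_sym. Qed.

Lemma complete_adj_irrefl t : irreflexive (@complete_adj t).
Proof. by move=> x; apply: negbTE; rewrite negbK. Qed.

Definition complete_graph (t : nat) : sgraph :=
  SGraph (@complete_adj_sym t) (@complete_adj_irrefl t).

Definition strong_adj (G H : sgraph) : rel (G * H) :=
  [rel u v | [|| (u.1 == v.1) && adj u.2 v.2,
                 (u.2 == v.2) && adj u.1 v.1
               | adj u.1 v.1 && adj u.2 v.2]].

Lemma strong_adj_sym (G H : sgraph) : symmetric (@strong_adj G H).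
Proof.
move=> u v; rewrite /strong_adj /= (eq_sym u.1) (eq_sym u.2).
by rewrite (adj_sym u.1) (adj_sym u.2).
Qed.

Lemma strong_adj_irrefl (G H : sgraph) : irreflexive (@strong_adj G H).
Proof. by move=> u; rewrite /strong_adj /= !adj_irrefl !andbF. Qed.

Definition strong_product (G H : sgraph) : sgraph :=
  SGraph (@strong_adj_sym G H) (@strong_adj_irrefl G H).

Definition proper_colouring (G : sgraph) (k : nat) (c : {ffun G -> 'I_k}) :
    bool :=
  [forall x, forall y, adj x y ==> (c x != c y)].

Definition colourable (G : sgraph) (k : nat) : bool :=
  [exists c : {ffun G -> 'I_k}, proper_colouring c].

Lemma colourable_ex (G : sgraph) : exists k, colourable G k.
Proof.
exists #|G|; apply/existsP; exists [ffun x => enum_rank x].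
apply/forallP=> x; apply/forallP=> y; apply/implyP=> exy.
rewrite !ffunE; apply: contraTneq exy => /enum_rank_inj ->.
by rewrite adj_irrefl.
Qed.

Definition chromatic_number (G : sgraph) : nat := ex_minn (colourable_ex G).

(* Adjacency of the subgraph G[A] induced by A, as a relation on G. *)
Definition induced_adj (G : sgraph) (A : {set G}) : rel G :=
  [rel x y | [&& x \in A, y \in A & adj x y]].

(* The vertex set of the connected component of G[A] containing x, for x in A;
   [connect] is the reflexive transitive closure. *)
Definition component (G : sgraph) (A : {set G}) (x : G) : {set G} :=
  [set y in A | connect (induced_adj A) x y].

Definition colour_class (G : sgraph) (k : nat) (c : {ffun G -> 'I_k})
    (i : 'I_k) : {set G} :=
  [set x | c x == i].

Definition clustered_colouring (t : nat) (G : sgraph) (k : nat)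
    (c : {ffun G -> 'I_k}) : bool :=
  [forall i, forall x in colour_class c i,
     #|component (colour_class c i) x| <= t].

Definition clustered_colourable (t : nat) (G : sgraph) (k : nat) : bool :=
  [exists c : {ffun G -> 'I_k}, clustered_colouring t c].

Lemma clustered_colourable_ex (t : nat) (t_gt0 : 0 < t) (G : sgraph) :
  exists k, clustered_colourable t G k.
Proof.
exists #|G|; apply/existsP; exists [ffun x => enum_rank x].
apply/forallP=> i; apply/forall_inP=> x.
rewrite inE ffunE => /eqP def_i.
apply: leq_trans t_gt0; rewrite -(cards1 x); apply: subset_leq_card.
apply/subsetP=> y; rewrite !inE ffunE -def_i => /andP[/eqP/enum_rank_inj-> _].
by [].
Qed.

(* For t = 0 a nonempty graph has no t-clustered colouring, hence the proof
   argument; the value does not depend on it. *)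
Definition clustered_chromatic_number (t : nat) (t_gt0 : 0 < t) (G : sgraph) :
    nat :=
  ex_minn (clustered_colourable_ex t_gt0 G).

(* Main.v *)
Require Import Defs.
From mathcomp Require Import all_boot.

Set Implicit Arguments.
Unset Strict Implicit.
Unset Printing Implicit Defensive.

(** For each [k], the graph [G] is properly [k]-colourable if and only if its
    strong product with [K_t] has a [t]-clustered [k]-colouring; the two
    chromatic numbers are then minima of the same set.

    From left to right, copy the colour of [v] to the whole fibre over [v]:
    adjacent fibres get different colours, so monochromatic components do not
    leave a fibre, and a fibre has [t] vertices.

    From right to left, let [c] be a [t]-clustered colouring of the product
    and match every vertex [v] of [G] with a monochromatic component of [c]
    that meets the fibre over [v], distinct vertices getting distinct
    components. Hall's condition for this matching is a count: the fibres over
    a set [S] have [t * #|S|] vertices in total, and the components that meet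
    them, of at most [t] vertices each, cover all of these, so there are at
    least [#|S|] such components ([component_count]). Hall's theorem
    ([hall_marriage]) gives the matching; colour [v] by the colour of its
    component. If [u] and [v] are adjacent, every vertex over [u] is adjacent
    to every vertex over [v], so equal colours would put the two chosen
    vertices into one component, against distinctness. *)

(** * Hall's marriage theorem *)

Definition hall_condition (A B : finType) (N : {ffun A -> {set B}}) : Prop :=
  forall S : {set A}, #|S| <= #|\bigcup_(a in S) N a|.

Definition remove_candidate (A B : finType) (N : {ffun A -> {set B}})
    (a : A) (x : B) : {ffun A -> {set B}} :=
  [ffun b => if b == a then N a :\ x else N b].

(** The sets that can violate Hall's condition after a removal at [a] are
    those that contain [a]; splitting [a] off leaves a set [S] on which the
    family has not changed. *)
Lemma hall_condition_remove (A B : finType) (N : {ffun A -> {set B}}) a x :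
    hall_condition N ->
    (forall S : {set A}, a \notin S ->
       #|S| < #|(\bigcup_(b in S) N b) :|: (N a :\ x)|) ->
  hall_condition (remove_candidate N a x).
Proof.
move=> hallN hallS S.
have unchanged (T : {set A}) : a \notin T ->
    \bigcup_(b in T) remove_candidate N a x b = \bigcup_(b in T) N b.
  move=> aT; apply: eq_bigr => b bT; rewrite ffunE; case: eqP => // ba.
  by rewrite -ba bT in aT.
case: (boolP (a \in S)) => aS; last by rewrite unchanged.
have aSa : a \notin S :\ a by rewrite !inE eqxx.
rewrite (cardsD1 a) aS (big_setD1 a aS) /= unchanged // ffunE eqxx setUC.
exact: hallS.
Qed.

(** Rado's argument: if neither [x] nor [y] could be removed, there would be
    sets [S] and [T] avoiding [a] such that the neighbourhood of [a |: S]
    without [x] has at most [#|S|] elements, and that of [a |: T] without [y]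
    at most [#|T|]. These two sets of neighbours cover the neighbourhood of
    [a |: (S :|: T)] and both contain that of [S :&: T], so Hall's condition
    gives at least [#|S :|: T| + 1 + #|S :&: T| = #|S| + #|T| + 1] for the sum
    of their sizes. *)
Lemma hall_removable (A B : finType) (N : {ffun A -> {set B}}) a x y :
    hall_condition N -> x != y ->
  hall_condition (remove_candidate N a x) \/
  hall_condition (remove_candidate N a y).
Proof.
move=> hallN xy.
pose tight z (S : {set A}) :=
  (a \notin S) && (#|(\bigcup_(b in S) N b) :|: (N a :\ z)| <= #|S|).
have removable z : (forall S, ~~ tight z S) ->
    hall_condition (remove_candidate N a z).
  move=> noS; apply: hall_condition_remove => // S aS.
  by move: (noS S); rewrite /tight aS /= -ltnNge.
case: (boolP [exists S, tight x S]) => [/existsP[S /andP[aS leS]] |]; last first.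
  by move/existsPn => noS; left; apply: removable.
case: (boolP [exists T, tight y T]) => [/existsP[T /andP[aT leT]] |]; last first.
  by move/existsPn => noT; right; apply: removable.
exfalso; move: leS leT.
set X := _ :|: (N a :\ x); set Y := _ :|: (N a :\ y) => leX leY.
have leU : #|S :|: T|.+1 <= #|X :|: Y|.
  have aST : a \notin S :|: T by rewrite inE negb_or aS.
  have := hallN (a |: (S :|: T)); rewrite cardsU1 aST /= => hallU.
  apply: leq_trans hallU _; apply/subset_leq_card/bigcupsP => b.
  rewrite !inE => /orP[/eqP-> | /orP[bS | bT]]; apply/subsetP => z zb.
  - rewrite !inE zb !andbT; case: (eqVneq z x) => [-> | _].
      by rewrite xy !orbT.
    by rewrite /= orbT.
  - by rewrite !inE; do 2!(apply/orP; left); apply/bigcupP; exists b.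
  - by rewrite !inE; apply/orP; right; apply/orP; left; apply/bigcupP; exists b.
have leI : #|S :&: T| <= #|X :&: Y|.
  apply: leq_trans (hallN _) _; apply/subset_leq_card/bigcupsP => b.
  rewrite inE => /andP[bS bT]; apply/subsetP => z zb.
  by rewrite !inE; apply/andP; split; apply/orP; left; apply/bigcupP; exists b.
have := leq_trans (leq_add leU leI) _.
move=> /(_ (#|S| + #|T|)); rewrite addSn !cardsUI ltnn => absurd.
by have := absurd (leq_add leX leY).
Qed.

(** By [hall_removable], a family satisfying Hall's condition can be shrunk
    until all its members are singletons. These are then pairwise distinct,
    by Hall's condition for two-element sets. *)
Theorem hall_marriage (A B : finType) (N : {ffun A -> {set B}}) :
    hall_condition N ->
  exists f : A -> B, injective f /\ forall a, f a \in N a.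
Proof.
have [n] := ubnP (\sum_a #|N a|); elim: n N => // n IHn N ltn hallN.
case: (boolP [exists a, 1 < #|N a|]) => [/existsP[a /card_gt1P] | /existsPn small].
  move=> [x [y [xN yN xy]]].
  have shrink z : z \in N a -> hall_condition (remove_candidate N a z) ->
      exists f : A -> B, injective f /\ forall b, f b \in N b.
    move=> zN hallz; have [|f [injf fN]] := IHn _ _ hallz.
      apply: leq_trans _ (ltn : \sum_b #|N b| <= n).
      rewrite (bigD1 a) // [X in _ <= X](bigD1 a) //= ffunE eqxx.
      rewrite (cardsD1 z (N a)) zN add1n addSn ltnS leq_add2l.
      by apply: leq_sum => b /negPf ba; rewrite ffunE ba.
    exists f; split=> // b; have := fN b; rewrite ffunE.
    by case: eqP => // ->; rewrite inE => /andP[].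
  by case: (hall_removable a hallN xy); apply: shrink.
have singleton a : exists b, N a = [set b].
  apply/cards1P; rewrite eqn_leq leqNgt small /=.
  by have := hallN [set a]; rewrite cards1 big_set1.
have [f fE] := fin_all_exists singleton.
exists f; split=> [a b fab | a]; last by rewrite fE set11.
apply/eqP/negPn/negP => ab; have := hallN [set a; b].
by rewrite cards2 ab big_setU1 ?inE //= big_set1 !fE fab setUid cards1.
Qed.

(** * Clustered colourings of strong products *)

Lemma clustered_strong_product (G H : sgraph) (t k : nat) :
  #|H| <= t -> colourable G k -> clustered_colourable t (strong_product G H) k.
Proof.
move=> Ht /existsP[c /forallP cP].
apply/existsP; exists [ffun u => c u.1].
apply/forallP => i; apply/forall_inP => x _; apply: leq_trans _ Ht.
set K := colour_class _ _.
have fibre_closed : closed (@induced_adj (strong_product G H) K)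
    [pred z | z.1 == x.1].
  move=> u v /and3P[]; rewrite !inE !ffunE => /eqP cu /eqP cv uv.
  suff -> : u.1 = v.1 by [].
  have diff : ~~ adj u.1 v.1.
    apply/negP => /(implyP (forallP (cP u.1) v.1)).
    by rewrite cu cv eqxx.
  move: uv; rewrite /= /strong_adj /= (negPf diff) andbF orbF.
  by move=> /andP[/eqP].
have <- : #|setX [set x.1] [set: H]| = #|H|.
  by rewrite cardsX cards1 mul1n cardsT.
apply/subset_leq_card/subsetP => -[v j]; rewrite !inE andbT => /andP[_ xv].
by have := closed_connect fibre_closed xv; rewrite !inE eqxx.
Qed.

Definition mono_component (G : sgraph) (k : nat) (c : {ffun G -> 'I_k})
    (x : G) : {set G} :=
  component (colour_class c (c x)) x.

Lemma mem_mono_component (G : sgraph) (k : nat) (c : {ffun G -> 'I_k}) x :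
  x \in mono_component c x.
Proof. by rewrite !inE eqxx connect0. Qed.

Lemma card_mono_component (G : sgraph) (t k : nat) (c : {ffun G -> 'I_k}) x :
  clustered_colouring t c -> #|mono_component c x| <= t.
Proof. by move/forallP/(_ (c x))/forall_inP; apply; rewrite inE. Qed.

Lemma mono_component_adj (G : sgraph) (k : nat) (c : {ffun G -> 'I_k}) x y :
  adj x y -> c x = c y -> mono_component c x = mono_component c y.
Proof.
move=> xy cxy; apply/setP => z.
have sym : connect_sym (induced_adj (colour_class c (c y))).
  by apply: sym_connect_sym => u v; rewrite /induced_adj /= adj_sym andbCA.
have cxy1 : connect (induced_adj (colour_class c (c y))) x y.
  by apply: connect1; rewrite /induced_adj /= !inE cxy eqxx.
by rewrite /mono_component cxy !inE (same_connect sym cxy1).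
Qed.

Lemma strong_adj_complete (G : sgraph) (t : nat) (u v : G) (i j : 'I_t) :
  adj u v -> @adj (strong_product G (complete_graph t)) (u, i) (v, j).
Proof. by move=> uv; rewrite /= /strong_adj /= uv andbT orbN orbT. Qed.

Definition fibre_components (G : sgraph) (t k : nat)
    (c : {ffun strong_product G (complete_graph t) -> 'I_k}) :
    {ffun G -> {set {set strong_product G (complete_graph t)}}} :=
  [ffun v => [set mono_component c (v, i) | i : 'I_t]].

(** The [t * #|S|] vertices over [S] are covered by the components that meet
    them, and each component covers at most [t]. *)
Lemma component_count (G : sgraph) (t k : nat)
    (c : {ffun strong_product G (complete_graph t) -> 'I_k}) :
  0 < t -> clustered_colouring t c -> hall_condition (fibre_components c).
Proof.
move=> t_gt0 cP S; set F := \bigcup_(v in S) _.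
rewrite -(leq_pmul2r t_gt0).
have -> : #|S| * t = #|setX S [set: 'I_t]| by rewrite cardsX cardsT card_ord.
apply: (@leq_trans #|cover F|).
  apply/subset_leq_card/subsetP => -[v i]; rewrite !inE andbT => vS.
  apply/bigcupP; exists (mono_component c (v, i)); last first.
    exact: (mem_mono_component c (v, i)).
  by apply/bigcupP; exists v => //; rewrite ffunE; apply: imset_f.
apply: leq_trans (leq_card_cover F) _.
rewrite -sum_nat_const; apply: leq_sum => C /bigcupP[v _].
by rewrite ffunE => /imsetP[i _ ->]; apply: card_mono_component.
Qed.

Lemma colourable_of_clustered (G : sgraph) (t k : nat) :
    0 < t ->
    clustered_colourable t (strong_product G (complete_graph t)) k ->
  colourable G k.
Proof.
move=> t_gt0 /existsP[c cP].
have [f [injf fN]] := hall_marriage (component_count t_gt0 cP).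
have representative v : exists i : 'I_t, f v = mono_component c (v, i).
  by have := fN v; rewrite ffunE => /imsetP[i _ ->]; exists i.
have [g fE] := fin_all_exists representative.
apply/existsP; exists [ffun v => c (v, g v)].
apply/forallP => u; apply/forallP => v; apply/implyP => uv; rewrite !ffunE.
apply/eqP => cuv.
have fuv : f u = f v.
  rewrite !fE; apply: mono_component_adj cuv.
  exact: strong_adj_complete.
by move: uv; rewrite (injf _ _ fuv) adj_irrefl.
Qed.

Theorem corollary20 (G : sgraph) (t : nat) (t_gt0 : 0 < t) :
  chromatic_number G =
    clustered_chromatic_number t_gt0 (strong_product G (complete_graph t)).
Proof.
apply: eq_ex_minn => k; apply/idP/idP; last exact: colourable_of_clustered.
by apply: clustered_strong_product; rewrite card_ord.
Qed.
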